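(* Let $m,N\ge 1$ be integers and let $\mathcal{F}=(\mathbb{R}^{m};f_{1},f_{2},\dots,f_{N})$ be an affine iterated function system, i.e. each $f_n:\mathbb{R}^m\to\mathbb{R}^m$ is an affine map. Then the following statements are equivalent. (1) $\mathcal{F}$ is hyperbolic. (2) $\mathcal{F}$ is point-fibred. (3) $\mathcal{F}$ has an attractor. (4) $\mathcal{F}$ is a topological contraction with respect to some convex body $K\subset\mathbb{R}^{m}$. (5) $\mathcal{F}$ is non-antipodal with respect to some convex body $K\subset\mathbb{R}^{m}$.
   Context: $\mathbb{R}^m$ carries the Euclidean metric $d_E(x,y)=\|x-y\|_2$. A metric $d$ on $\mathbb{R}^m$ is Lipschitz equivalent to $d_E$ if there are constants $r,R>0$ with $r\,d_E(x,y)\le d(x,y)\le R\,d_E(x,y)$ for all $x,y$. A map $f$ is a contraction with respect to $d$ if there is $\alpha\in[0,1)$ with $d(f(x),f(y))\le\alpha\, d(x,y)$ for all $x,y$. A convex body is a compact convex subset of $\mathbb{R}^m$ with non-empty interior. $\Omega=\{1,\dots,N\}^{\infty}$ is the set of infinite sequences $\sigma=\sigma_1\sigma_2\sigma_3\cdots$, with the product topology. Hyperbolic: there is a metric on $\mathbb{R}^m$, Lipschitz equivalent to $d_E$, with respect to which every $f_n$ is a contraction. Coding map: a continuous map $\pi:\Omega\to\mathbb{R}^m$ such that $f_n(\pi(\sigma))=\pi(n\sigma)$ for all $n\in\{1,\dots,N\}$ and $\sigma\in\Omega$, where $n\sigma$ denotes the sequence $n\sigma_1\sigma_2\cdots$.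 Point-fibred: for each $\sigma\in\Omega$ the limit $\pi(\sigma):=\lim_{k\to\infty}f_{\sigma_1}\circ f_{\sigma_2}\circ\cdots\circ f_{\sigma_k}(x)$ exists, is independent of $x\in\mathbb{R}^m$, and the resulting map $\pi:\Omega\to\mathbb{R}^m$ is a coding map. Attractor: let $\mathbb{H}$ be the set of nonempty compact subsets of $\mathbb{R}^m$ with the Hausdorff metric, and for $B\in\mathbb{H}$ put $\mathcal{F}(B)=\bigcup_{n=1}^N f_n(B)$, with $k$-fold iterate $\mathcal{F}^{\circ k}$. A set $A\in\mathbb{H}$ is an attractor of $\mathcal{F}$ if $A=\mathcal{F}(A)$ and $A=\lim_{k\to\infty}\mathcal{F}^{\circ k}(B)$ in the Hausdorff metric for every $B\in\mathbb{H}$. Topological contraction with respect to $K$: $\mathcal{F}(K)\subset \operatorname{int}(K)$. Non-antipodal: for a convex body $K$ and a unit vector $u\in S^{m-1}$, let $H_u$ and $H_{-u}$ be the two distinct supporting hyperplanes of $K$ orthogonal to $u$, namely $H_u=\{x:\langle x,u\rangle=\max_{y\in K}\langle y,u\rangle\}$ and $H_{-u}=\{x:\langle x,u\rangle=\min_{y\in K}\langle y,u\rangle\}$. Put $\mathcal{A}_u(K)=(H_u\cap\partial K)\times(H_{-u}\cap\partial K)$ and $\mathcal{A}(K)=\bigcup_{u\in S^{m-1}}\mathcal{A}_u(K)$ (the set of antipodal pairs of $K$). A map $f:\mathbb{R}^m\to\mathbb{R}^m$ is non-antipodal with respect to $K$ if $f(K)\subseteq K$ and $(x,y)\in\mathcal{A}(K)$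 implies $(f(x),f(y))\notin\mathcal{A}(K)$. $\mathcal{F}$ is non-antipodal with respect to $K$ if each $f_n$ is. *)

(* Defs.v *)
From HB Require Import structures.
From mathcomp Require Import all_boot all_order all_algebra.
From mathcomp Require Import all_classical all_reals all_analysis.

Set Implicit Arguments.
Unset Strict Implicit.
Unset Printing Implicit Defensive.

Import Order.TTheory GRing.Theory Num.Theory.
Import numFieldNormedType.Exports.

Local Open Scope classical_set_scope.
Local Open Scope ring_scope.

(* R^m is 'rV[R]_m.  Its library topology (compact, interior, closure, limits,
   continuity) is the product topology, which is the topology of dE; the library
   norm `|x| and ball are those of the sup norm and are not used as a metric. *)

Section Euclidean.
Variables (R : realType) (m : nat).
Implicit Types x y : 'rV[R]_m.

Definition dot x y : R := \sum_i x ord0 i * y ord0 i.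

Definition enorm x : R := Num.sqrt (dot x x).

Definition dE x y : R := enorm (x - y).

Definition is_metric (d : 'rV[R]_m -> 'rV[R]_m -> R) : Prop :=
  [/\ forall x y, 0 <= d x y,
      forall x y, d x y = 0 <-> x = y,
      forall x y, d x y = d y x &
      forall x y z, d x z <= d x y + d y z].

Definition lipschitz_equivalent (d : 'rV[R]_m -> 'rV[R]_m -> R) : Prop :=
  exists r s : R, [/\ 0 < r, 0 < s &
    forall x y, r * dE x y <= d x y /\ d x y <= s * dE x y].

Definition is_contraction (d : 'rV[R]_m -> 'rV[R]_m -> R)
    (f : 'rV[R]_m -> 'rV[R]_m) : Prop :=
  exists a : R, [/\ 0 <= a, a < 1 & forall x y, d (f x) (f y) <= a * d x y].

(* Vectors are rows, so the linear part acts by multiplication on the right. *)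
Definition is_affine (f : 'rV[R]_m -> 'rV[R]_m) : Prop :=
  exists (A : 'M[R]_m) (b : 'rV[R]_m), forall x, f x = x *m A + b.

(* Only meaningful on nonempty bounded sets: inf and sup are total on R. *)
Definition hausdorff_dist (A B : set 'rV[R]_m) : R :=
  Num.max (sup [set inf [set dE x y | y in B] | x in A])
          (sup [set inf [set dE x y | x in A] | y in B]).

Definition nonempty_compact (B : set 'rV[R]_m) : Prop := compact B /\ B !=set0.

Definition convex_body (K : set 'rV[R]_m) : Prop :=
  [/\ compact K, @convex_set R 'rV[R]_m K & K° !=set0].

Definition boundary (K : set 'rV[R]_m) : set 'rV[R]_m := closure K `\` K°.

(* On a nonempty compact K, sup and inf are the max and min of <., u> on K. *)
Definition upper_hyperplane (K : set 'rV[R]_m) (u : 'rV[R]_m) : set 'rV[R]_m :=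
  [set x | dot x u = sup [set dot y u | y in K]].

Definition lower_hyperplane (K : set 'rV[R]_m) (u : 'rV[R]_m) : set 'rV[R]_m :=
  [set x | dot x u = inf [set dot y u | y in K]].

Definition antipodal_pairs_dir (K : set 'rV[R]_m) (u : 'rV[R]_m) :
    set ('rV[R]_m * 'rV[R]_m) :=
  (upper_hyperplane K u `&` boundary K) `*`
  (lower_hyperplane K u `&` boundary K).

Definition antipodal_pairs (K : set 'rV[R]_m) : set ('rV[R]_m * 'rV[R]_m) :=
  \bigcup_(u in [set u : 'rV[R]_m | enorm u = 1]) antipodal_pairs_dir K u.

Definition non_antipodal_map (K : set 'rV[R]_m)
    (f : 'rV[R]_m -> 'rV[R]_m) : Prop :=
  f @` K `<=` K /\
  forall x y, antipodal_pairs K (x, y) -> ~ antipodal_pairs K (f x, f y).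

End Euclidean.

Section IFS.
Variables (R : realType) (m N : nat) (f : 'I_N -> 'rV[R]_m -> 'rV[R]_m).

Definition hyperbolic : Prop :=
  exists d : 'rV[R]_m -> 'rV[R]_m -> R,
    [/\ is_metric d, lipschitz_equivalent d & forall n, is_contraction d (f n)].

(* Symbols are numbered from 0: sigma i is the (i+1)-st letter of sigma. *)
Definition code_space := {ptws nat -> discrete_topology 'I_N}.

Definition prepend (n : 'I_N) (sigma : code_space) : code_space :=
  fun i => if i is j.+1 then sigma j else n.

Definition coding_map (pi : code_space -> 'rV[R]_m) : Prop :=
  continuous pi /\ forall n sigma, f n (pi sigma) = pi (prepend n sigma).

(* foldr f x [:: s1; ...; sk] is f s1 (f s2 (... (f sk x))). *)
Definition point_fibred : Prop :=
  exists pi : code_space -> 'rV[R]_m,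
    (forall sigma x, foldr f x (mkseq sigma k) @[k --> \oo] --> pi sigma) /\
    coding_map pi.

Definition ifs_image (B : set 'rV[R]_m) : set 'rV[R]_m :=
  \bigcup_n (f n @` B).

Definition is_attractor (A : set 'rV[R]_m) : Prop :=
  [/\ nonempty_compact A, A = ifs_image A &
      forall B, nonempty_compact B ->
        hausdorff_dist (iter k ifs_image B) A @[k --> \oo] --> (0 : R)].

Definition topological_contraction (K : set 'rV[R]_m) : Prop :=
  ifs_image K `<=` K°.

Definition non_antipodal (K : set 'rV[R]_m) : Prop :=
  forall n, non_antipodal_map K (f n).

End IFS.

(* Main.v *)
Require Import Defs.
From mathcomp Require Import all_boot all_order all_algebra.
From mathcomp Require Import all_classical all_reals all_analysis.
From mathcomp Require Import ring lra.

Set Implicit Arguments.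
Unset Strict Implicit.
Unset Printing Implicit Defensive.

Import Order.TTheory GRing.Theory Num.Theory.
Import numFieldNormedType.Exports.

Local Open Scope classical_set_scope.
Local Open Scope ring_scope.

(** Write [A_w] for the linear part of the composition of the maps along a word
    [w].  The first four properties are tied together by joint contractivity of
    the linear parts: [|A_w| <= C lam^|w|] for some [lam < 1].

    A hyperbolic system is jointly contractive, since contraction factors
    multiply and the metric is comparable to the norm.  Joint contractivity makes
    the compositions along an address converge geometrically and uniformly, which
    gives a coding map ([jointly_contractive_point_fibred]).

    Conversely, if the compositions converge along every address to a point that
    does not depend on the start, then [A_w] tends to zero along every address.
    By compactness of the code space, every address has a prefix of bounded
    length whose linear part halves norms; cutting words into such prefixes gives
    joint contractivity ([point_fibred_jointly_contractive]), and then the image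
    of the coding map attracts compact sets uniformly
    ([point_fibred_attractor]).

    An attractor is bounded, so for some [k] all the compositions of [k] maps send
    a ball much larger than the attractor into its unit neighbourhood.  For affine
    maps this forces their linear parts to halve norms
    ([attractor_jointly_contractive]).  The norm [sup_w lam^-|w| |x A_w|] is then
    contracted by every linear part ([adapted_norm]), and every large ball of it
    is a convex body that the system maps into its interior.

    A map that sends [K] into its interior is non-antipodal because antipodal
    points lie on the boundary.  The return to hyperbolicity rests on the norm
    whose unit ball is the difference body [K - K]: its unit vectors are the
    differences of antipodal pairs.  A map of [K] into itself has a linear part
    of norm at most 1, and norm 1 would be attained, by compactness, on a pair
    that is antipodal together with its image ([polar_norm_contraction]). *)

(** * Euclidean and maximum norms *)

Lemma lipschitz_bound_continuous (R : realType) (V W : normedModType R)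
    (g : V -> W) (c : R) :
  (forall x y, `|g x - g y| <= c * `|x - y|) -> continuous g.
Proof.
move=> g_lip x; apply/cvgrPdist_le => e e0; near=> y.
apply: le_trans (g_lip x y) _.
have c1 : 0 < `|c| + 1 by rewrite ltr_wpDl.
apply: (@le_trans _ _ ((`|c| + 1) * `|x - y|)).
  by rewrite ler_wpM2r // (le_trans (ler_norm c)) // lerDl.
rewrite mulrC -ler_pdivlMr //.
by near: y; apply: cvgr_dist_le; [exact: cvg_id | rewrite divr_gt0].
Unshelve. all: by end_near.
Qed.

Section Norms.
Variables (R : realType) (m : nat).
Implicit Types (x y u : 'rV[R]_m) (A : 'M[R]_m) (K : set 'rV[R]_m).

Lemma dotDl x y u : dot (x + y) u = dot x u + dot y u.
Proof. by rewrite /dot -big_split; apply: eq_bigr => i _; rewrite mxE mulrDl. Qed.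

Lemma dotZl (a : R) x u : dot (a *: x) u = a * dot x u.
Proof. by rewrite /dot big_distrr; apply: eq_bigr => i _; rewrite mxE -mulrA. Qed.

Lemma dotC x u : dot x u = dot u x.
Proof. by apply: eq_bigr => i _; rewrite mulrC. Qed.

Lemma dotZr (a : R) x u : dot x (a *: u) = a * dot x u.
Proof. by rewrite dotC dotZl dotC. Qed.

Lemma dotBl x y u : dot (x - y) u = dot x u - dot y u.
Proof. by rewrite -scaleN1r dotDl dotZl mulN1r. Qed.

Lemma dot0l u : dot 0 u = 0.
Proof. by rewrite -(scale0r 0) dotZl mul0r. Qed.

Lemma dot_mulmx x A u : dot (x *m A) u = dot x (u *m A^T).
Proof.
have E y v : dot y v = (y *m v^T) 0 0.
  by rewrite mxE; apply: eq_bigr => i _; rewrite mxE.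
by rewrite !E trmx_mul trmxK mulmxA.
Qed.

Lemma coord_le_norm x i : `|x ord0 i| <= `|x|.
Proof.
rewrite [leRHS]/Num.norm /= mx_normrE.
by apply: le_trans (le_bigmax _ _ (ord0, i)).
Qed.

Lemma norm_le_coord x (c : R) :
  0 <= c -> (forall i, `|x ord0 i| <= c) -> `|x| <= c.
Proof.
move=> c0 h; rewrite [leLHS]/Num.norm /= mx_normrE.
by apply/bigmax_leP; split=> // -[i j] _ /=; rewrite ord1.
Qed.

Lemma dot_self_ge0 x : 0 <= dot x x.
Proof. by apply: sumr_ge0 => i _; rewrite -expr2 sqr_ge0. Qed.

Lemma enorm_ge0 x : 0 <= enorm x.
Proof. exact: sqrtr_ge0. Qed.

Lemma sqr_enorm x : enorm x ^+ 2 = dot x x.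
Proof. by rewrite sqr_sqrtr // dot_self_ge0. Qed.

Lemma norm_le_enorm x : `|x| <= enorm x.
Proof.
apply: norm_le_coord => [|i]; first exact: enorm_ge0.
rewrite -[leLHS]sqrtr_sqr ler_sqrt ?dot_self_ge0 //.
rewrite /dot (bigD1 i) //= -expr2 lerDl.
by apply: sumr_ge0 => j _; rewrite -expr2 sqr_ge0.
Qed.

Lemma dot_le_norm x u : dot x u <= m%:R * (`|x| * `|u|).
Proof.
rewrite -[m in m%:R]card_ord -sumr_const mulr_suml; apply: ler_sum => i _.
rewrite mul1r (le_trans (ler_norm _)) // normrM.
by rewrite ler_pM ?coord_le_norm.
Qed.

Lemma enorm_le_norm x : enorm x <= m.+1%:R * `|x|.
Proof.
rewrite -ler_sqr ?nnegrE ?enorm_ge0 ?mulr_ge0 // sqr_enorm.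
apply: le_trans (dot_le_norm _ _) _.
rewrite exprMn -expr2 ler_wpM2r ?sqr_ge0 // -natrX ler_nat.
by rewrite (leq_trans (leqnSn m)) // expnS expn1 leq_pmulr.
Qed.

Lemma enorm_eq0 x : enorm x = 0 -> x = 0.
Proof.
by move=> h; apply/normr0_eq0/eqP; rewrite eq_le normr_ge0 -h norm_le_enorm.
Qed.

Lemma enormZ (a : R) x : 0 <= a -> enorm (a *: x) = a * enorm x.
Proof.
move=> a0; rewrite /enorm dotZl dotZr mulrA sqrtrM ?mulr_ge0 //.
by rewrite sqrtr_sqr ger0_norm.
Qed.

Lemma row_sum_delta_norm x A :
  `|x *m A| <= (\sum_i `|(delta_mx ord0 i : 'rV[R]_m) *m A|) * `|x|.
Proof.
rewrite {1}[x]row_sum_delta mulmx_suml mulr_suml.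
apply: le_trans (ler_norm_sum _ _ _) _; apply: ler_sum => i _.
by rewrite -scalemxAl normrZ mulrC ler_wpM2l // coord_le_norm.
Qed.

Lemma compact_norm_bound K :
  compact K -> exists2 M : R, 0 < M & forall x, K x -> `|x| <= M.
Proof.
move=> /compact_bounded [M [_ h]]; exists (Num.max 1 (M + 1)).
  by rewrite lt_max ltr01.
by apply: h; rewrite lt_max ltrDl ltr01 orbT.
Qed.

Lemma norm_ball_compact (c : R) : compact [set x : 'rV[R]_m | `|x| <= c].
Proof.
apply: bounded_closed_compact.
  by exists c; split; [exact: num_real | move=> M /ltW cM x /= /le_trans; apply].
apply: (@closed_comp 'rV[R]_m R (fun x : 'rV[R]_m => `|x|) [set y | y <= c]).
  by move=> x _; exact: (@norm_continuous R).
exact: closed_le.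
Qed.

Lemma hausdorff_dist_le (B D : set 'rV[R]_m) (e : R) :
  B !=set0 -> D !=set0 ->
  (forall x, B x -> exists2 y, D y & dE x y <= e) ->
  (forall y, D y -> exists2 x, B x & dE x y <= e) ->
  0 <= hausdorff_dist B D <= e.
Proof.
move=> B0 D0 BD DB.
have sup_inf_bound (X Y : set 'rV[R]_m) (g : 'rV[R]_m -> 'rV[R]_m -> R) :
    (forall x y, 0 <= g x y) -> X !=set0 ->
    (forall x, X x -> exists2 y, Y y & g x y <= e) ->
    0 <= sup [set inf [set g x y | y in Y] | x in X] <= e.
  move=> g0 [x0 Xx0] XY.
  have inf_e x : X x -> 0 <= inf [set g x y | y in Y] <= e.
    move=> /XY [y Yy ge]; apply/andP; split.
      by apply: lb_le_inf; [exists (g x y), y | move=> _ [z _ <-]].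
    apply: le_trans ge; apply: ge_inf; last by exists y.
    by exists 0 => _ [z _ <-].
  have ub : ubound [set inf [set g x y | y in Y] | x in X] e.
    by move=> _ [x Xx <-]; have /andP[] := inf_e x Xx.
  apply/andP; split; last first.
    by apply: ge_sup => //; exists (inf [set g x0 y | y in Y]), x0.
  have /andP[h _] := inf_e x0 Xx0; apply: le_trans h _.
  by apply: sup_ubound; [exists e | exists x0].
have dE0 x y : 0 <= dE x y by exact: enorm_ge0.
have /andP[h1 h2] := sup_inf_bound B D (@dE R m) dE0 B0 BD.
have /andP[h3 h4] :=
  sup_inf_bound D B (fun y x => dE x y) (fun y x => dE0 x y) D0 DB.
by rewrite /hausdorff_dist le_max h1 /= ge_max h2 h4.
Qed.

End Norms.

Lemma geometric_small (R : realType) (C lam e : R) :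
  0 < C -> 0 < lam -> lam < 1 -> 0 < e ->
  \forall k \near \oo, C * lam ^+ k <= e.
Proof.
move=> C0 lam0 lam1 e0.
have h : `|lam| < 1 by rewrite gtr0_norm.
have /cvgr0Pnorm_le /(_ (e / C)) := cvg_expr h.
rewrite divr_gt0 // => /(_ isT); apply: filterS => k.
by rewrite ger0_norm ?exprn_ge0 ?(ltW lam0) // ler_pdivlMr // mulrC.
Qed.

Lemma cvg_dot (R : realType) (m : nat) (T : Type) (F : set_system T) (FF : Filter F)
    (p q : T -> 'rV[R]_m) (x y : 'rV[R]_m) :
  p @ F --> x -> q @ F --> y -> dot (p t) (q t) @[t --> F] --> dot x y.
Proof.
move=> px qy; apply: cvg_big => [|i _]; first exact: add_continuous.
have coord_cvg (g : T -> 'rV[R]_m) (z : 'rV[R]_m) :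
    g @ F --> z -> g t ord0 i @[t --> F] --> z ord0 i.
  apply: (@continuous_cvg _ _ _ _ _ g (fun v : 'rV[R]_m => v ord0 i)).
  exact: coord_continuous.
by apply: cvgM; exact: coord_cvg.
Qed.

(** * Products of the linear parts *)

Section Words.
Variables (R : realType) (m N : nat) (A : 'I_N -> 'M[R]_m).
Implicit Types (x y : 'rV[R]_m) (w p q : seq 'I_N).

(** Vectors are rows, so the linear part of [f_1 \o ... \o f_k] is the product of
    the matrices in reverse order. *)
Definition word_mx w : 'M[R]_m := foldr (fun n M => M *m A n) 1%:M w.

Lemma word_mx_cat p q : word_mx (p ++ q) = word_mx q *m word_mx p.
Proof. by elim: p => [|n p IH] /=; rewrite ?mulmx1 // IH mulmxA. Qed.

Definition word_mx_decay (C lam : R) : Prop :=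
  forall w x, `|x *m word_mx w| <= C * lam ^+ size w * `|x|.

(** The joint spectral radius of the linear parts is smaller than 1.  All the
    dynamical properties are compared through this one. *)
Definition jointly_contractive : Prop :=
  exists C lam : R, [/\ 0 < C, 0 < lam, lam < 1 & word_mx_decay C lam].

Lemma word_mx_bound K : exists2 M : R, 0 < M &
  forall w, (size w <= K)%N -> forall x, `|x *m word_mx w| <= M * `|x|.
Proof.
pose c n := \sum_i `|(delta_mx ord0 i : 'rV[R]_m) *m A n|.
have c0 n : 0 <= c n by apply: sumr_ge0.
pose B := 1 + \sum_n c n.
have B1 : 1 <= B by rewrite lerDl sumr_ge0.
have cB n : c n <= B.
  by rewrite /B (bigD1 n) //= addrCA lerDl addr_ge0 // sumr_ge0.
have B0 : 0 < B := lt_le_trans ltr01 B1.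
exists (B ^+ K); first by rewrite exprn_gt0.
move=> w wK x; apply: (@le_trans _ _ (B ^+ size w * `|x|)); last first.
  by rewrite ler_wpM2r // ler_weXn2l.
elim: w {wK} x => [|n w IH] x /=; first by rewrite mulmx1 mul1r.
rewrite mulmxA exprS -mulrA; apply: le_trans (row_sum_delta_norm _ _) _.
by apply: ler_pM => //; [exact: c0 | exact: cB].
Qed.

(** Bernoulli's inequality for [lam = 1 - 1/(2(K+1))]; this stands in for a
    [K]-th root of [1/2]. *)
Lemma exists_rate (K : nat) :
  exists lam : R, [/\ 0 < lam, lam < 1 & 2^-1 <= lam ^+ K].
Proof.
pose a : R := (2 * K.+1%:R)^-1.
have a0 : 0 < a by rewrite invr_gt0 mulr_gt0.
have aK : a * K.+1%:R = 2^-1 by rewrite /a invfM -mulrA mulVf ?mulr1.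
have a1 : a <= 2^-1 by rewrite -aK ler_peMr ?(ltW a0) ?ler1n.
have bernoulli k : 1 - k%:R * a <= (1 - a) ^+ k.
  elim: k => [|k IH]; first by rewrite mul0r subr0.
  have : (1 - k%:R * a) * (1 - a) <= (1 - a) ^+ k.+1.
    by rewrite exprSr ler_wpM2r //; lra.
  apply: le_trans; rewrite -natr1.
  have : 0 <= k%:R * a * a by rewrite !mulr_ge0 // ltW.
  lra.
exists (1 - a); split; [lra | lra |].
apply: le_trans (bernoulli K).
have : K%:R * a <= 2^-1 by rewrite -aK mulrC ler_wpM2l ?(ltW a0) ?ler_nat.
lra.
Qed.

(** Cutting a long word into prefixes of length at most [K], each of which
    halves the norm, costs only a bounded remainder. *)
Lemma decay_of_halving_prefixes (K : nat) :
  (forall w, (K <= size w)%N -> exists k, [/\ (0 < k)%N, (k <= K)%N &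
     forall x, `|x *m word_mx (take k w)| <= 2^-1 * `|x|]) ->
  jointly_contractive.
Proof.
move=> halve; have [lam [lam0 lam1 lamK]] := exists_rate K.
have [M M0 shortM] := word_mx_bound K.
have C0 : 0 < M / lam ^+ K by rewrite divr_gt0 // exprn_gt0.
exists (M / lam ^+ K), lam; split=> // w.
have [n] := ubnP (size w); elim: n w => // n IH w wn x.
have [wK | Kw] := ltnP (size w) K.
  apply: le_trans (shortM w (ltnW wK) x) _.
  rewrite ler_wpM2r // -mulrA ler_peMr ?(ltW M0) //.
  rewrite mulrC ler_pdivlMr ?exprn_gt0 // mul1r.
  by rewrite ler_wiXn2l ?(ltW lam0) ?(ltW lam1) ?(ltnW wK).
have [k [k0 kK half]] := halve w Kw.
have kw : (k <= size w)%N := leq_trans kK Kw.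
rewrite -{1}(cat_take_drop k w) word_mx_cat mulmxA.
apply: le_trans (half _) _.
have dropn : (size (drop k w) < n)%N.
  rewrite size_drop -ltnS (leq_trans _ wn) // ltnS -subSn // leq_subLR.
  by rewrite -addn1 addnC leq_add2r.
apply: (@le_trans _ _ (lam ^+ k * (M / lam ^+ K * lam ^+ size (drop k w) * `|x|))).
  apply: ler_pM => //; last exact: IH.
  by rewrite (le_trans lamK) // ler_wiXn2l ?(ltW lam0) ?(ltW lam1).
by rewrite mulrA [lam ^+ k * _]mulrCA -exprD size_drop subnKC.
Qed.

(** Weighting the orbit of [x] under the linear parts by the inverse rate turns
    joint contractivity into strict contraction by one and the same norm. *)
Lemma adapted_norm : jointly_contractive ->
  exists (nu : 'rV[R]_m -> R) (C lam : R),
  [/\ 0 < lam < 1,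
      forall x, `|x| <= nu x <= C * `|x|,
      forall x y, nu (x + y) <= nu x + nu y,
      forall (a : R) x, 0 <= a -> nu (a *: x) <= a * nu x &
      forall n x, nu (x *m A n) <= lam * nu x].
Proof.
move=> [C [lam [C0 lam0 lam1 decay]]].
pose term x w := `|x *m word_mx w| / lam ^+ size w.
pose nu x := sup (range (term x)).
have lamX k : 0 < lam ^+ k by rewrite exprn_gt0.
have term_bound x w : term x w <= C * `|x|.
  by rewrite ler_pdivrMr // mulrAC decay.
have nu_ge x w : term x w <= nu x.
  apply: sup_ubound; last by exists w.
  by exists (C * `|x|) => _ [v _ <-].
have nu_le x c : (forall w, term x w <= c) -> nu x <= c.
  by move=> h; apply: ge_sup => [|_ [w _ <-] //]; exists (term x [::]), [::].
exists nu, C, lam; split; first by rewrite lam0.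
- move=> x; rewrite nu_le // andbT; apply: le_trans (nu_ge x [::]).
  by rewrite /term mulmx1 expr0 divr1.
- move=> x y; apply: nu_le => w; apply: le_trans (lerD (nu_ge x w) (nu_ge y w)).
  by rewrite -mulrDl ler_wpM2r ?invr_ge0 ?(ltW (lamX _)) // mulmxDl ler_normD.
- move=> a x a0; apply: nu_le => w.
  rewrite /term -scalemxAl normrZ ger0_norm // -mulrA ler_wpM2l //.
  exact: nu_ge.
- move=> n x; apply: nu_le => w.
  apply: (@le_trans _ _ (lam * term x (rcons w n))); last first.
    by rewrite ler_pM2l //; exact: nu_ge.
  rewrite /term -cats1 word_mx_cat /= mul1mx size_cat addn1 exprS mulmxA.
  rewrite le_eqVlt; apply/orP; left; apply/eqP.
  by field; rewrite !gt_eqF.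
Qed.

End Words.

(** * The code space *)

Section CodeSpace.
Variable N : nat.
Implicit Types (sigma : code_space N) (w : seq 'I_N).

Lemma mkseq_add (sigma : nat -> 'I_N) k j :
  mkseq sigma (k + j) = mkseq sigma k ++ mkseq (fun i => sigma (k + i)%N) j.
Proof.
rewrite /mkseq iotaD map_cat add0n; congr (_ ++ _).
by rewrite -{1}[k]addn0 iotaDl -map_comp.
Qed.

Lemma mkseq_prepend n sigma k : mkseq (prepend n sigma) k.+1 = n :: mkseq sigma k.
Proof. by rewrite /mkseq /= (iotaDl 1 0) -map_comp. Qed.

Lemma mkseq_nth_take (n0 : 'I_N) w k :
  (k <= size w)%N -> mkseq (nth n0 w) k = take k w.
Proof.
move=> kw; apply: (@eq_from_nth _ n0) => [|i]; rewrite size_mkseq ?size_takel //.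
by move=> ik; rewrite nth_mkseq // nth_take.
Qed.

Lemma cylinder_nbhs sigma k :
  \forall tau \near sigma, mkseq tau k = mkseq sigma k.
Proof.
have FF : Filter (nbhs sigma).
  exact: (@nbhs_filter {ptws nat -> discrete_topology 'I_N} sigma).
elim: k => [|k IH]; first exact: filterE.
have h : \forall tau \near sigma, tau k = sigma k.
  exact: (@proj_continuous nat (fun=> discrete_topology 'I_N) k sigma _
    (discrete_set1 _)).
apply: filterS2 IH h => tau eq_k eq_tau; rewrite -[k.+1]addn1 !mkseq_add eq_k.
by rewrite /mkseq /= addn0 eq_tau.
Qed.

Lemma code_space_compact : compact [set: code_space N].
Proof.
have finC : forall i : nat, compact [set: discrete_topology 'I_N].
  by move=> _; apply: finite_compact; exact: finite_finset.
have h := @tychonoff nat (fun=> discrete_topology 'I_N) (fun=> setT) finC.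
have -> // : [set: code_space N] = [set sigma |
    forall i : nat, [set: discrete_topology 'I_N] (sigma i)].
by apply/seteqP; split.
Qed.

End CodeSpace.

(** * Contractivity, point fibres and attractors *)

Section AffineIFS.
Variables (R : realType) (m N : nat) (f : 'I_N -> 'rV[R]_m -> 'rV[R]_m).
Variables (A : 'I_N -> 'M[R]_m) (b : 'I_N -> 'rV[R]_m).
Hypothesis f_def : forall n x, f n x = x *m A n + b n.
Implicit Types (x y : 'rV[R]_m) (w p q : seq 'I_N) (sigma : code_space N).

Lemma foldr_sub x y w : foldr f x w - foldr f y w = (x - y) *m word_mx A w.
Proof.
elim: w => [|n w IH] /=; first by rewrite mulmx1.
by rewrite !f_def opprD addrACA subrr addr0 -mulmxBl IH mulmxA.
Qed.

(** Large balls of the adapted norm are trapping: the contraction of the radius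
    outweighs the translations. *)
Lemma trapping_norm : jointly_contractive A ->
  exists (nu : 'rV[R]_m -> R) (C r0 : R),
  [/\ forall x, `|x| <= nu x <= C * `|x|,
      forall x y, nu (x + y) <= nu x + nu y,
      forall (a : R) x, 0 <= a -> nu (a *: x) <= a * nu x,
      0 < r0 &
      forall r, r0 <= r -> forall n x, nu x <= r -> nu (f n x) < r].
Proof.
move=> /adapted_norm [nu [C [lam [/andP[lam0 lam1] nuE nuD nuZ nuA]]]].
have nu0 x : 0 <= nu x by have /andP[+ _] := nuE x; exact: le_trans.
pose c := \sum_n nu (b n).
have c0 : 0 <= c by apply: sumr_ge0.
have nub n : nu (b n) <= c by rewrite /c (bigD1 n) //= lerDl sumr_ge0.
have lamB : 0 < 1 - lam by rewrite subr_gt0.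
exists nu, C, ((c + 1) / (1 - lam)); split=> //.
  by rewrite divr_gt0 // ltr_wpDl.
move=> r; rewrite ler_pdivrMr // => rr0 n x xr.
rewrite f_def; apply: le_lt_trans (nuD _ _) _.
have := nuA n x; have := nub n; have : lam * nu x <= lam * r by rewrite ler_pM2l.
lra.
Qed.

Lemma orbit_bounded x : jointly_contractive A ->
  exists2 D : R, 0 < D & forall w, `|foldr f x w| <= D.
Proof.
move=> /trapping_norm [nu [C [r0 [nuE _ _ r0_gt0 trap]]]].
exists (Num.max r0 (nu x)); first by rewrite lt_max r0_gt0.
move=> w; have /andP[h _] := nuE (foldr f x w); apply: le_trans h _.
elim: w => [|n w IH] /=; first by rewrite le_max lexx orbT.
by apply/ltW/trap => //; rewrite le_max lexx.
Qed.

(** Contractions of one metric compose, and the metric is comparable to the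
    norm, so only the constant depends on the comparison. *)
Lemma hyperbolic_jointly_contractive :
  hyperbolic f -> jointly_contractive A.
Proof.
case=> d [[d_ge0 d_eq0 d_sym d_tri] [r [s [r0 s0 dE_d]]]] /choice[a contr].
pose lam : R := \big[Num.max/2^-1]_n a n.
have a_lam n : a n <= lam by apply: le_bigmax.
have lam0 : 0 < lam by apply: lt_le_trans (bigmax_ge_id _ _ _ _); rewrite invr_gt0.
have lam1 : lam < 1.
  apply/bigmax_ltP; split=> [|n _]; first by rewrite invf_lt1 // ltr1n.
  by have [] := contr n.
exists (s / r * m.+1%:R), lam; split=> //.
  by rewrite mulr_gt0 // divr_gt0.
move=> w x.
have dw y z : d (foldr f y w) (foldr f z w) <= lam ^+ size w * d y z.
  elim: w => [|n w IH] /=; first by rewrite mul1r.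
  have [_ _ h] := contr n; apply: le_trans (h _ _) _.
  rewrite exprS -mulrA; apply: (@le_trans _ _ (lam * d (foldr f y w) (foldr f z w))).
    by rewrite ler_wpM2r.
  by rewrite ler_pM2l.
have lamw : 0 <= lam ^+ size w by rewrite exprn_ge0 // ltW.
rewrite -{1}[x]subr0 -foldr_sub; apply: le_trans (norm_le_enorm _) _.
have [+ _] := dE_d (foldr f x w) (foldr f 0 w).
rewrite -/(dE _ _) -ler_pdivlMl // => /le_trans; apply.
rewrite ler_pdivrMl //; apply: le_trans (dw x 0) _.
have -> : r * (s / r * m.+1%:R * lam ^+ size w * `|x|)
        = lam ^+ size w * (s * (m.+1%:R * `|x|)) by field; rewrite gt_eqF.
apply: ler_wpM2l => //.
have [_ +] := dE_d x 0; move=> /le_trans; apply.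
by rewrite ler_pM2l // /dE subr0 enorm_le_norm.
Qed.
Lemma f_continuous n : continuous (f n).
Proof.
apply: lipschitz_bound_continuous => x y.
by rewrite !f_def opprD addrACA subrr addr0 -mulmxBl; exact: row_sum_delta_norm.
Qed.

(** Since [f_(pq) y - f_p x] is the image of [f_q y - x] under the linear part
    of [f_p], the orbits of any two points along the same address merge
    geometrically. *)
Lemma orbit_rate (C lam D : R) x y p q :
  0 < C -> 0 < lam -> word_mx_decay A C lam ->
  (forall w, `|foldr f y w| <= D) ->
  `|foldr f y (p ++ q) - foldr f x p| <= C * lam ^+ size p * (D + `|x|).
Proof.
move=> C0 lam0 decay yD; rewrite foldr_cat foldr_sub.
apply: le_trans (decay _ _) _; rewrite ler_wpM2l //.
  by rewrite mulr_ge0 ?exprn_ge0 // ltW.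
by apply: le_trans (ler_normB _ _) _; rewrite lerD2r.
Qed.

(** The orbits of [0] along an address form a Cauchy sequence at a rate that does
    not depend on the address.  This uniformity makes the limit continuous, and
    merging of orbits makes it independent of the starting point. *)
Lemma jointly_contractive_point_fibred :
  jointly_contractive A -> point_fibred f.
Proof.
move=> jcA; have [C [lam [C0 lam0 lam1 decay]]] := jcA.
have [D D0 orbD] := orbit_bounded 0 jcA.
pose u sigma k := foldr f 0 (mkseq sigma k).
have CD0 : 0 < C * D by rewrite mulr_gt0.
have uB sigma k j : `|u sigma (k + j)%N - u sigma k| <= C * D * lam ^+ k.
  have := @orbit_rate C lam D 0 0 (mkseq sigma k)
    (mkseq (fun i => sigma (k + i)%N) j) C0 lam0 decay orbD.
  by rewrite -mkseq_add size_mkseq normr0 addr0 mulrAC.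
have ucvg sigma : cvg (u sigma @ \oo).
  apply/cauchy_cvgP/cauchy_exP => e e0.
  have [k _ kP] := geometric_small CD0 lam0 lam1 (divr_gt0 e0 (ltr0n R 2)).
  exists (u sigma k), k => // j /= kj; rewrite -ball_normE /= distrC -(subnKC kj).
  apply: le_lt_trans (uB _ _ _) _; apply: le_lt_trans (kP k _) _ => //=.
  by rewrite ltr_pdivrMr // ltr_pMr // ltr1n.
pose pi sigma := lim (u sigma @ \oo).
have piB sigma k : `|pi sigma - u sigma k| <= C * D * lam ^+ k.
  have h : `|u sigma j - u sigma k| @[j --> \oo] --> `|pi sigma - u sigma k|.
    by apply: cvg_norm; apply: cvgB; [apply: ucvg | apply: cvg_cst].
  apply: (cvgr_to_le h); exists k => // j /= kj.
  by rewrite -(subnKC kj).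
have pi_lim sigma x : foldr f x (mkseq sigma k) @[k --> \oo] --> pi sigma.
  have CE0 : 0 < C * D + C * (D + `|x|).
    by rewrite ltr_wpDr // mulr_ge0 ?addr_ge0 ?(ltW C0) ?(ltW D0).
  apply/cvgrPdist_le => e e0.
  have [K _ KP] := geometric_small CE0 lam0 lam1 e0.
  exists K => // k /= Kk; apply: le_trans (KP k Kk).
  have := @orbit_rate C lam D x 0 (mkseq sigma k) [::] C0 lam0 decay orbD.
  have := piB sigma k; rewrite cats0 size_mkseq -/(u sigma k) => h1 h2.
  rewrite -(subrKA (u sigma k)); apply: le_trans (ler_normD _ _) _.
  by rewrite mulrDl lerD // mulrAC.
exists pi; split=> //; split.
- move=> sigma.
  have FF : Filter (nbhs sigma).
    exact: (@nbhs_filter {ptws nat -> discrete_topology 'I_N} sigma).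
  apply/(@cvgrPdist_le R 'rV[R]_m _ _ FF) => e e0.
  have CE0 : 0 < C * D + C * D by rewrite addr_gt0.
  have [k _ kP] := geometric_small CE0 lam0 lam1 e0.
  have := cylinder_nbhs sigma k; apply: filterS => tau eq_tau.
  apply: le_trans (kP k (leqnn k)).
  rewrite -(subrKA (u sigma k)); apply: le_trans (ler_normD _ _) _.
  rewrite mulrDl lerD // distrC.
  by have := piB tau k; rewrite /u eq_tau.
- move=> n sigma.
  have h1 : f n (u sigma k) @[k --> \oo] --> f n (pi sigma).
    exact: (cvg_comp _ _ (ucvg sigma) (@f_continuous n _)).
  have h2 : u (prepend n sigma) k.+1 @[k --> \oo] --> pi (prepend n sigma).
    by rewrite (cvg_shiftS (u (prepend n sigma))); exact: ucvg.
  have E : (fun k => u (prepend n sigma) k.+1) = fun k => f n (u sigma k).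
    by apply/funext => k; rewrite /u mkseq_prepend.
  by rewrite E in h2; apply: (cvg_unique (@norm_hausdorff _ _) h1 h2).
Qed.

(** Along each address the linear parts tend to zero, so some prefix halves
    norms; having that prefix is an open condition on the address, and the code
    space is compact, so the length of the prefix can be bounded uniformly. *)
Lemma point_fibred_jointly_contractive (n0 : 'I_N) :
  point_fibred f -> jointly_contractive A.
Proof.
case=> pi [pi_lim _].
pose halves w := forall x, `|x *m word_mx A w| <= 2^-1 * `|x|.
pose P K sigma := exists k, [/\ (0 < k)%N, (k <= K)%N & halves (mkseq sigma k)].
(* The linear part of a composition is the difference of its values at a basis
   vector and at 0, and both orbits converge to the point with address [sigma]. *)
have halving_prefix sigma : exists k, (0 < k)%N /\ halves (mkseq sigma k).
  pose S k := \sum_i `|(delta_mx ord0 i : 'rV[R]_m) *m word_mx A (mkseq sigma k)|.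
  have S0 : S k @[k --> \oo] --> (0 : R).
    have -> : (0 : R) = \sum_(i < m) 0 by rewrite big1.
    apply: cvg_big => [|i _]; first exact: add_continuous.
    rewrite -[X in _ --> X](normr0 'rV[R]_m).
    apply: cvg_norm; rewrite -(subrr (pi sigma)).
    under eq_fun do rewrite -[delta_mx _ _]subr0 -foldr_sub.
    by apply: cvgB; exact: pi_lim.
  have half0 : (0 : R) < 2^-1 by rewrite invr_gt0.
  have /cvgr0Pnorm_le /(_ _ half0) [k _ kP] := S0.
  (* [k.+1] rather than [k], since the prefix must be nonempty *)
  exists k.+1; split=> // x; apply: le_trans (row_sum_delta_norm _ _) _.
  rewrite ler_wpM2r // (le_trans (ler_norm _)) //.
  by apply: kP => /=.
have [K _ KP] : \forall K \near \oo, [set: code_space N] `<=` P K.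
  apply: (iffLR (compact_near_coveringP _) (@code_space_compact N)) => sigma _.
  have [k [k0 kP]] := halving_prefix sigma.
  exists ([set tau | mkseq tau k = mkseq sigma k], [set K | (k <= K)%N]).
    by split; [exact: cylinder_nbhs | exists k].
  by case=> tau K [/= eq_tau kK]; exists k; rewrite eq_tau.
apply: (@decay_of_halving_prefixes _ _ _ A K) => w Kw.
have [k [k0 kK half]] := KP K (leqnn K) (nth n0 w) I.
exists k; split=> // x; rewrite -(mkseq_nth_take n0) //.
exact: leq_trans kK Kw.
Qed.

Lemma iter_ifs_imageE k (B : set 'rV[R]_m) :
  iter k (ifs_image f) B =
    [set y | exists w x, [/\ size w = k, B x & y = foldr f x w]].
Proof.
elim: k => [|k IH].
  apply/seteqP; split=> [x Bx | _ [w [x [/size0nil -> Bx ->]]] //].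
  by exists [::], x.
rewrite iterS IH; apply/seteqP; split.
  by move=> _ [n _ [_ [w [x [<- Bx ->]]] <-]]; exists (n :: w), x.
move=> _ [[|n w] [x [wk Bx ->]]] //; case: wk => wk.
by exists n => //; exists (foldr f x w) => //; exists w, x.
Qed.

(** The attractor is the image of the code space.  The point with address
    [sigma] is the image under the first [k] maps of the point whose address is
    the [k]-fold shift of [sigma], so it is uniformly close to the image of any
    point of [B] under the same maps. *)
Lemma point_fibred_attractor (n0 : 'I_N) :
  point_fibred f -> exists A0 : set 'rV[R]_m, is_attractor f A0.
Proof.
move=> pf; have [C [lam [C0 lam0 lam1 decay]]] :=
  point_fibred_jointly_contractive n0 pf.
have [pi [pi_lim [pi_cont pi_eq]]] := pf.
pose sigma0 : code_space N := fun=> n0.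
pose A0 := [set pi sigma | sigma in [set: code_space N]].
have cA0 : compact A0.
  apply: continuous_compact; last exact: code_space_compact.
  exact: continuous_subspaceT.
have A00 : A0 !=set0 by exists (pi sigma0), sigma0.
exists A0; split=> //.
  apply/seteqP; split.
    move=> _ [sigma _ <-]; exists (sigma 0%N) => //.
    exists (pi (fun i => sigma i.+1)); first by exists (fun i => sigma i.+1).
    by rewrite pi_eq; congr pi; apply/funext => -[].
  by move=> _ [n _ [_ [sigma _ <-] <-]]; exists (prepend n sigma).
move=> B [cB B0].
have [M M0 BM] := compact_norm_bound cB.
have [D D0 AD] := compact_norm_bound cA0.
pose shift k (sigma : code_space N) : code_space N := fun i => sigma (k + i)%N.
have pi_shift k sigma : pi sigma = foldr f (pi (shift k sigma)) (mkseq sigma k).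
  elim: k => [|k IH]; first by rewrite /=; congr pi; apply/funext.
  rewrite -[k.+1]addn1 mkseq_add foldr_cat IH /= addn0 pi_eq.
  congr (foldr _ (pi _) _); apply/funext => -[|i] /=; rewrite /shift ?addn0 //.
  by rewrite addn1 addSnnS.
have near_pi k sigma x : B x ->
    dE (foldr f x (mkseq sigma k)) (pi sigma) <= m.+1%:R * C * (M + D) * lam ^+ k.
  move=> Bx; rewrite (pi_shift k) /dE foldr_sub.
  apply: le_trans (enorm_le_norm _) _.
  rewrite -!mulrA ler_pM2l //; apply: le_trans (decay _ _) _.
  rewrite size_mkseq -!mulrA ler_pM2l // mulrC ler_wpM2r ?exprn_ge0 ?(ltW lam0) //.
  apply: le_trans (ler_normB _ _) _; rewrite lerD ?BM // AD //.
  by exists (shift k sigma).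
apply/cvgr0Pnorm_le => e e0.
have CE0 : 0 < m.+1%:R * C * (M + D) by rewrite !mulr_gt0 ?addr_gt0.
have [K _ KP] := geometric_small CE0 lam0 lam1 e0.
exists K => // k /= /KP Kk.
have /andP[h1 h2] : 0 <= hausdorff_dist (iter k (ifs_image f) B) A0 <= e.
  rewrite iter_ifs_imageE; have [x0 Bx0] := B0.
  apply: hausdorff_dist_le => //.
  - by exists (foldr f x0 (nseq k n0)), (nseq k n0), x0; rewrite size_nseq.
  - move=> _ [w [x [wk Bx ->]]]; exists (pi (nth n0 w)); first by exists (nth n0 w).
    apply: le_trans Kk; have := near_pi k (nth n0 w) x Bx.
    by rewrite mkseq_nth_take -?wk // take_size.
  - move=> _ [sigma _ <-]; exists (foldr f x0 (mkseq sigma k)).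
      by exists (mkseq sigma k), x0; rewrite size_mkseq.
    by apply: le_trans Kk; exact: near_pi.
by rewrite ger0_norm.
Qed.

Lemma ifs_image_bounded (B : set 'rV[R]_m) (M : R) :
  (forall x, B x -> `|x| <= M) ->
  exists M' : R, forall x, ifs_image f B x -> `|x| <= M'.
Proof.
move=> BM; have [c c0 cA] := word_mx_bound A 1.
exists (c * M + \sum_n `|b n|) => _ [n _ [x Bx <-]]; rewrite f_def.
apply: le_trans (ler_normD _ _) (lerD _ _).
  have := cA [:: n] isT x; rewrite /= mul1mx => /le_trans; apply.
  by rewrite ler_pM2l // BM.
by rewrite (bigD1 n) //= lerDl sumr_ge0.
Qed.

(** A word whose map sends a large ball into the unit neighbourhood of the
    bounded set [A0] has a linear part that shrinks the radius of that ball to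
    the diameter of that neighbourhood. *)
Lemma attractor_jointly_contractive (A0 : set 'rV[R]_m) :
  is_attractor f A0 -> jointly_contractive A.
Proof.
move=> [[cA0 A00] _ attr].
have [D D0 AD] := compact_norm_bound cA0.
(* The image of the ball of radius [rho] will have diameter at most [rho / 2]. *)
pose rho : R := 4 * (D + 1).
have rho0 : 0 < rho by rewrite mulr_gt0 // addr_gt0.
pose B := [set x : 'rV[R]_m | `|x| <= rho].
have B_ne : nonempty_compact B.
  by split; [exact: norm_ball_compact | exists 0; rewrite /B /= normr0 ltW].
have /cvgr0Pnorm_lt /(_ _ ltr01) [k _ kP] := attr B B_ne.
have {kP} := kP k.+1 (leqnSn k); set K := k.+1 => hK.
have [M FM] : exists M : R, forall x, iter K (ifs_image f) B x -> `|x| <= M.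
  elim: K {hK} => [|j [M FM]]; first by exists rho.
  exact: ifs_image_bounded FM.
have [a0 Aa0] := A00.
have into_nbhd w x : size w = K -> `|x| <= rho -> `|foldr f x w| <= D + 1.
  move=> wK xB; set y := foldr f x w.
  have Fy : iter K (ifs_image f) B y by rewrite iter_ifs_imageE; exists w, x.
  have inf1 : inf [set dE y a | a in A0] < 1.
    apply: le_lt_trans hK; apply: le_trans (ler_norm _).
    rewrite /hausdorff_dist le_max; apply/orP; left.
    apply: sup_ubound; last by exists y.
    exists (m.+1%:R * (M + D)) => _ [z Fz <-].
    apply: (@le_trans _ _ (dE z a0)).
      apply: ge_inf; last by exists a0.
      by exists 0 => _ [a _ <-]; exact: enorm_ge0.
    apply: le_trans (enorm_le_norm _) _; rewrite ler_pM2l //.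
    by apply: le_trans (ler_normB _ _) _; rewrite lerD ?FM ?AD.
  have [_ [a Aa <-] da] : exists2 s, [set dE y a | a in A0] s & s < 1.
    by apply: inf_lt inf1; exists (dE y a0), a0.
  rewrite -(subrK a y) addrC; apply: le_trans (ler_normD _ _) _.
  rewrite lerD ?AD //; apply: le_trans (norm_le_enorm _) _; exact: ltW.
apply: (@decay_of_halving_prefixes _ _ _ A K) => w Kw.
exists K; split=> // x.
have wK : size (take K w) = K by rewrite size_takel.
have [->|x0] := eqVneq x 0; first by rewrite mul0mx normr0 mulr0.
have nx0 : 0 < `|x| by rewrite normr_gt0.
have t0 : 0 < rho / `|x| by rewrite divr_gt0.
have ballx : `|(rho / `|x|) *: x| <= rho.
  by rewrite normrZ gtr0_norm // divfK // gt_eqF.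
have ball0 : `|0 : 'rV[R]_m| <= rho by rewrite normr0 ltW.
have h : `|((rho / `|x|) *: x) *m word_mx A (take K w)| <= 2^-1 * rho.
  rewrite -[_ *: x]subr0 -foldr_sub; apply: le_trans (ler_normB _ _) _.
  have := into_nbhd _ _ wK ballx; have := into_nbhd _ _ wK ball0.
  rewrite /rho; lra.
move: h; rewrite -scalemxAl normrZ gtr0_norm // => h.
rewrite -(ler_pM2l t0); apply: le_trans h _.
by rewrite [leRHS]mulrCA divfK ?gt_eqF.
Qed.

(** A trapping ball of the adapted norm is a convex body, and its image lies in
    the open ball of the same radius. *)
Lemma jointly_contractive_topological_contraction :
  jointly_contractive A ->
  exists K : set 'rV[R]_m, convex_body K /\ topological_contraction f K.
Proof.
move=> /trapping_norm [nu [C [r [nuE nuD nuZ r0 trap]]]].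
have nu_cont : continuous nu.
  apply: (@lipschitz_bound_continuous R 'rV[R]_m R _ C) => x y.
  have B u v : nu u - nu v <= C * `|u - v|.
    rewrite lerBlDl -{1}(subrK v u) addrC; apply: le_trans (nuD _ _) _.
    by rewrite lerD2l; have /andP[] := nuE (u - v).
  by rewrite ler_norml B andbT lerNl opprB distrC B.
have open_ball : open [set x | nu x < r].
  apply: (@open_comp _ _ nu [set s | s < r]) => [x _|]; last exact: open_lt.
  exact: nu_cont.
pose K := [set x | nu x <= r].
have ball_int : [set x | nu x < r] `<=` K°.
  by rewrite -open_subsetE // => x /ltW.
have nu00 : nu 0 <= 0 by have /andP[_] := nuE 0; rewrite normr0 mulr0.
exists K; split; last first.
  by move=> _ [n _ [x Kx <-]]; apply: ball_int; exact: trap.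
split.
- apply: bounded_closed_compact.
    exists r; split; [exact: num_real | move=> M /ltW rM x Kx /=].
    by have /andP[h _] := nuE x; apply: le_trans h (le_trans Kx rM).
  apply: (@closed_comp _ _ nu [set s | s <= r]) => [x _|]; last exact: closed_le.
  exact: nu_cont.
- move=> x y t; rewrite !inE /K /= => xr yr.
  have t0 : 0 <= t%:num by exact: ge0.
  have t1 : 0 <= 1 - t%:num by rewrite subr_ge0; exact: le1.
  apply: le_trans (nuD _ _) _.
  apply: le_trans (lerD (nuZ _ x t0) (nuZ _ y t1)) _.
  have := ler_wpM2l t0 xr; have := ler_wpM2l t1 yr; lra.
- by exists 0; apply: ball_int; exact: le_lt_trans nu00 r0.
Qed.

End AffineIFS.

(** * Antipodal pairs and the polar of the difference body *)

Section Polar.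
Variables (R : realType) (m : nat) (K : set 'rV[R]_m).
Implicit Types (x y u v : 'rV[R]_m).

(** The polar body of [K - K]: the functionals of width at most 1 on [K]. *)
Definition difference_polar : set 'rV[R]_m :=
  [set u | forall x y, K x -> K y -> dot (x - y) u <= 1].

Lemma interior_absorbs x : K° x ->
  exists2 e : R, 0 < e & forall v, `|v| <= e -> K (x + v).
Proof.
move=> /nbhs_ballP [e /= e0 xeK]; exists (e / 2); first by rewrite divr_gt0.
move=> v ve; apply: xeK; rewrite -ball_normE /= opprD addNKr normrN.
by rewrite (le_lt_trans ve) // ltr_pdivrMr // ltr_pMr // ltr1n.
Qed.

(** A nonzero functional takes larger and smaller values near any interior point,
    hence the points of a supporting hyperplane lie on the boundary. *)
Lemma interior_not_extremal x u : K° x -> u != 0 ->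
  (exists2 z, K z & dot x u < dot z u) /\ (exists2 z, K z & dot z u < dot x u).
Proof.
move=> /interior_absorbs [e e0 xeK] u0.
have nu0 : 0 < `|u| by rewrite normr_gt0.
pose t := e / `|u|; have t0 : 0 < t by rewrite divr_gt0.
have tu : `|t *: u| <= e by rewrite normrZ gtr0_norm // divfK // gt_eqF.
have uu : 0 < t * dot u u.
  rewrite mulr_gt0 // -sqr_enorm exprn_gt0 //.
  exact: lt_le_trans nu0 (norm_le_enorm _).
split; [exists (x + t *: u) | exists (x - t *: u)].
- exact: xeK.
- by rewrite dotDl dotZl ltrDl.
- by apply: xeK; rewrite normrN.
- by rewrite dotBl dotZl ltrBlDr ltrDl.
Qed.

Lemma extremal_antipodal x y u : u != 0 -> K x -> K y ->
  (forall z, K z -> dot y u <= dot z u <= dot x u) -> antipodal_pairs K (x, y).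
Proof.
move=> u0 Kx Ky ext.
have Eu : 0 < enorm u.
  rewrite lt_neqAle enorm_ge0 andbT eq_sym; apply: contra_neq u0; exact: enorm_eq0.
have iE0 : 0 <= (enorm u)^-1 by rewrite invr_ge0 ltW.
have subK : K `<=` closure K := @subset_closure _ K.
exists ((enorm u)^-1 *: u) => /=.
  by rewrite enormZ // mulVf // gt_eqF.
split; split=> /=.
- rewrite /upper_hyperplane /=; apply/eqP; rewrite eq_le; apply/andP; split.
    apply: sup_ubound; last by exists x.
    exists (dot x ((enorm u)^-1 *: u)) => _ [z Kz <-].
    by rewrite !dotZr ler_wpM2l //; have /andP[] := ext z Kz.
  apply: ge_sup => [|_ [z Kz <-]]; first by exists (dot x ((enorm u)^-1 *: u)), x.
  by rewrite !dotZr ler_wpM2l //; have /andP[] := ext z Kz.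
- split; [exact: subK | move=> /interior_not_extremal/(_ u0) [[z Kz]]].
  by have /andP[_ +] := ext z Kz; rewrite leNgt => /negP.
- rewrite /lower_hyperplane /=; apply/eqP; rewrite eq_le; apply/andP; split.
    apply: lb_le_inf => [|_ [z Kz <-]].
      by exists (dot y ((enorm u)^-1 *: u)), y.
    by rewrite !dotZr ler_wpM2l //; have /andP[] := ext z Kz.
  apply: ge_inf; last by exists y.
  exists (dot y ((enorm u)^-1 *: u)) => _ [z Kz <-].
  by rewrite !dotZr ler_wpM2l //; have /andP[] := ext z Kz.
- split; [exact: subK | move=> /interior_not_extremal/(_ u0) [_ [z Kz]]].
  by have /andP[+ _] := ext z Kz; rewrite leNgt => /negP.
Qed.

(** A functional of width 1 whose values at two points of [K] differ by 1 attains
    its maximum at the one and its minimum at the other. *)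
Lemma difference_polar_antipodal x y u : K x -> K y -> difference_polar u ->
  dot (x - y) u = 1 -> antipodal_pairs K (x, y).
Proof.
move=> Kx Ky Uu xy1; apply: (@extremal_antipodal _ _ u) => //.
  apply/eqP => u0; move: xy1; rewrite u0 dotC dot0l => /eqP.
  by rewrite eq_sym oner_eq0.
move=> z Kz; have := Uu _ _ Kx Kz; have := Uu _ _ Kz Ky; rewrite -xy1 !dotBl.
by move=> h1 h2; apply/andP; split; lra.
Qed.

Lemma difference_polar_opp u : difference_polar u -> difference_polar (- u).
Proof.
move=> Uu x y Kx Ky; rewrite -[- u]scaleN1r dotZr mulN1r dotBl opprB -dotBl.
exact: Uu.
Qed.

Lemma difference_polar0 : difference_polar 0.
Proof. by move=> x y _ _; rewrite dotC dot0l. Qed.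

(** Testing [u] on a segment of [K] in the direction of [u], around an interior
    point, bounds [u]. *)
Lemma difference_polar_bound : K° !=set0 ->
  exists2 M : R, 0 < M & forall u, difference_polar u -> `|u| <= M.
Proof.
move=> [c Kc]; have [e e0 ceK] := interior_absorbs Kc.
exists e^-1 => [|u Uu]; first by rewrite invr_gt0.
have [->|u0] := eqVneq u 0; first by rewrite normr0 invr_ge0 ltW.
have nu0 : 0 < `|u| by rewrite normr_gt0.
have Kcu : K (c + (e / `|u|) *: u).
  by apply: ceK; rewrite normrZ gtr0_norm ?divr_gt0 // divfK // gt_eqF.
have := Uu _ _ Kcu (interior_subset Kc).
rewrite addrAC subrr add0r dotZl -sqr_enorm.
rewrite -[e^-1]mul1r ler_pdivlMr //; apply: le_trans.
have -> : `|u| * e = e / `|u| * `|u| ^+ 2 by field; rewrite gt_eqF.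
rewrite ler_pM2l ?divr_gt0 // ler_sqr ?nnegrE ?enorm_ge0 //.
exact: norm_le_enorm.
Qed.

Lemma difference_polar_compact : K° !=set0 -> compact difference_polar.
Proof.
move=> /difference_polar_bound [M M0 UM]; apply: bounded_closed_compact.
  exists M; split; first exact: num_real.
  by move=> c /ltW Mc u Uu; exact: le_trans (UM u Uu) Mc.
have -> : difference_polar = \bigcap_(p in K `*` K) [set u | dot (p.1 - p.2) u <= 1].
  apply/seteqP; split=> [u Uu [x y] [/= Kx Ky] | u Uu x y Kx Ky]; first exact: Uu.
  exact: (Uu (x, y)).
apply: closed_bigI => -[x y] _ /=.
apply: (@closed_comp _ _ (dot (x - y)) [set s | s <= 1]) => [u _|];
  last exact: closed_le.
apply: (@lipschitz_bound_continuous R 'rV[R]_m R _ (m%:R * `|x - y|)) => {}u v.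
have dist_le a c : dot (x - y) a - dot (x - y) c <= m%:R * `|x - y| * `|a - c|.
  by rewrite ![dot (x - y) _]dotC -dotBl dotC -mulrA dot_le_norm.
rewrite ler_norml; apply/andP; split; last exact: dist_le.
by rewrite lerNl opprB; apply: le_trans (dist_le v u) _; rewrite (distrC v u).
Qed.

End Polar.

Section PolarNorm.
Variables (R : realType) (m : nat) (K : set 'rV[R]_m).
Hypothesis K_body : convex_body K.
Implicit Types (x y u v : 'rV[R]_m).
Local Notation U := (difference_polar K).

(** The support function of the polar, which is the Minkowski functional of
    [K - K].  In this form, contraction of the norm by a linear map is a
    statement on the transposed map and the functionals of [K]. *)
Definition polar_norm v : R := sup [set dot v u | u in U].

Let polar_norm_ub v : has_ubound [set dot v u | u in U].
Proof.
have [_ _ /difference_polar_bound [M M0 UM]] := K_body.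
exists (m%:R * (`|v| * M)) => _ [u Uu <-]; apply: le_trans (dot_le_norm _ _) _.
by rewrite ler_wpM2l // ler_wpM2l // UM.
Qed.

Lemma polar_norm_ge v u : U u -> dot v u <= polar_norm v.
Proof. by move=> Uu; apply: sup_ubound; [exact: polar_norm_ub | exists u]. Qed.

Lemma polar_norm_le v c : (forall u, U u -> dot v u <= c) -> polar_norm v <= c.
Proof.
move=> h; apply: ge_sup => [|_ [u Uu <-]]; last exact: h.
by exists (dot v 0), 0 => //; exact: difference_polar0.
Qed.

Lemma polar_norm_ge0 v : 0 <= polar_norm v.
Proof. by rewrite -(dot0l v) dotC polar_norm_ge //; exact: difference_polar0. Qed.

Lemma polar_normN v : polar_norm (- v) = polar_norm v.
Proof.
have le w : polar_norm (- w) <= polar_norm w.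
  apply: polar_norm_le => u Uu.
  rewrite -scaleN1r dotZl -dotZr scaleN1r; apply: polar_norm_ge.
  exact: difference_polar_opp.
by apply/eqP; rewrite eq_le le -{1}[v]opprK le.
Qed.

Lemma polar_normD v w : polar_norm (v + w) <= polar_norm v + polar_norm w.
Proof.
by apply: polar_norm_le => u Uu; rewrite dotDl lerD // polar_norm_ge.
Qed.

Lemma polar_norm_upper :
  exists2 s : R, 0 < s & forall v, polar_norm v <= s * enorm v.
Proof.
have [_ _ /difference_polar_bound [M M0 UM]] := K_body.
exists (m.+1%:R * M) => [|v]; first by rewrite mulr_gt0.
apply: polar_norm_le => u Uu; apply: le_trans (dot_le_norm _ _) _.
rewrite -mulrA [M * _]mulrC; apply: ler_pM; rewrite ?mulr_ge0 ?ler_nat //.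
by apply: ler_pM; rewrite ?norm_le_enorm ?UM.
Qed.

(** The polar contains a ball because [K] is bounded, so it contains a multiple
    of [v] itself. *)
Lemma polar_norm_lower :
  exists2 r : R, 0 < r & forall v, r * enorm v <= polar_norm v.
Proof.
have [cK _ _] := K_body; have [M M0 KM] := compact_norm_bound cK.
pose r : R := (m.+1%:R * (2 * M))^-1.
have r0 : 0 < r by rewrite invr_gt0 !mulr_gt0.
exists r => // v; have [->|v0] := eqVneq v 0.
  by rewrite /enorm dot0l sqrtr0 mulr0 polar_norm_ge0.
have nv0 : 0 < `|v| by rewrite normr_gt0.
have Uv : U ((r / `|v|) *: v).
  move=> x y Kx Ky; rewrite dotZr mulrAC ler_pdivrMr // mul1r.
  rewrite ler_pdivrMl ?mulr_gt0 //.
  apply: le_trans (dot_le_norm _ _) _; rewrite -[leRHS]mulrA.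
  apply: ler_pM; rewrite ?mulr_ge0 ?ler_nat //.
  rewrite ler_wpM2r // mulr2n mulrDl mul1r; apply: le_trans (ler_normB _ _) _.
  by rewrite lerD ?KM.
apply: le_trans (polar_norm_ge v Uv); rewrite dotZr -sqr_enorm mulrAC ler_pdivlMr //.
by rewrite -mulrA ler_pM2l // expr2 ler_wpM2l ?enorm_ge0 // norm_le_enorm.
Qed.

End PolarNorm.

(** Let [a] be the maximum of [<g x - g y, u>] over [x] and [y] in [K] and [u] in
    the polar of [K - K].  Pulling functionals back through the linear part of
    [g] maps the polar into [a] times itself, so [a] bounds the operator norm.
    As [g] maps [K] into itself, [a <= 1].  If the value 1 is reached at
    [(x0, y0, u0)], then [u0] has width 1 on [K] and sees [(g x0, g y0)] as an
    antipodal pair, while its pull-back also has width 1 and sees [(x0, y0)] as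
    one: this is exactly what non-antipodality excludes. *)
Lemma polar_norm_contraction (R : realType) (m : nat) (K : set 'rV[R]_m)
    (g : 'rV[R]_m -> 'rV[R]_m) (A : 'M[R]_m) :
  convex_body K -> continuous g -> (forall x y, g x - g y = (x - y) *m A) ->
  non_antipodal_map K g ->
  exists a : R, [/\ 0 <= a, a < 1 &
    forall v, polar_norm K (v *m A) <= a * polar_norm K v].
Proof.
move=> K_body g_cont gA [gK nonantip].
have gKx x : K x -> K (g x) by move=> Kx; apply: gK; exists x.
have [cK _ K0] := K_body.
pose U := difference_polar K.
have cU : compact U := difference_polar_compact K0.
pose h (q : ('rV[R]_m * 'rV[R]_m) * 'rV[R]_m) := dot (g q.1.1 - g q.1.2) q.2.
have h_cont : continuous h.
  move=> q; apply: cvg_dot; last exact: cvg_snd.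
  apply: cvgB.
    apply: (@continuous_cvg _ _ _ _ _ (fun p : ('rV[R]_m * 'rV[R]_m) * _ => p.1.1) g);
      first exact: g_cont.
    by apply: (@continuous_comp _ _ _ fst fst); [exact: cvg_fst | exact: cvg_fst].
  apply: (@continuous_cvg _ _ _ _ _ (fun p : ('rV[R]_m * 'rV[R]_m) * _ => p.1.2) g);
      first exact: g_cont.
  by apply: (@continuous_comp _ _ _ fst snd); [exact: cvg_fst | exact: cvg_snd].
have K_ne : K !=set0 by have [c /interior_subset Kc] := K0; exists c.
have D0 : (K `*` K) `*` U !=set0.
  by have [c Kc] := K_ne; exists ((c, c), 0); split=> //; exact: difference_polar0.
have cD : compact ((K `*` K) `*` U).
  by apply: compact_setX => //; apply: compact_setX.
have [[[x0 y0] u0]] := compact_EVT_max D0 cD (continuous_subspaceT h_cont).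
rewrite inE => -[[/= Kx0 Ky0] Uu0] hmax.
have {hmax} hmax x y u : K x -> K y -> U u ->
    dot (g x - g y) u <= dot (g x0 - g y0) u0.
  by move=> Kx Ky Uu; apply: (hmax ((x, y), u)); rewrite inE.
set alpha := dot (g x0 - g y0) u0 in hmax.
have alpha1 : alpha < 1.
  have := Uu0 _ _ (gKx _ Kx0) (gKx _ Ky0).
  rewrite -/alpha le_eqVlt => /orP[/eqP alphaE | //].
  have antip_g := difference_polar_antipodal (gKx _ Kx0) (gKx _ Ky0) Uu0 alphaE.
  exfalso; apply: nonantip antip_g.
  apply: (@difference_polar_antipodal _ _ _ _ _ (u0 *m A^T)) => //.
    by move=> x y Kx Ky; rewrite -dot_mulmx -gA -alphaE; exact: hmax.
  by rewrite -dot_mulmx -gA.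
(* [alpha] may vanish, and the pulled back functionals are divided by [a]. *)
pose a := Num.max alpha 2^-1.
have a0 : 0 < a by rewrite lt_max invr_gt0 ltr0n orbT.
exists a; split; first exact: ltW.
  by rewrite gt_max alpha1 /= invf_lt1 // ltr1n.
move=> v; apply: polar_norm_le => u Uu.
rewrite dot_mulmx -ler_pdivrMl // -dotZr; apply: (polar_norm_ge K_body) => x y Kx Ky.
rewrite dotZr ler_pdivrMl // mulr1 -dot_mulmx -gA.
by apply: le_trans (hmax _ _ _ Kx Ky Uu) _; rewrite le_max lexx.
Qed.

(** * The equivalence *)

(** Antipodal pairs consist of boundary points, which the maps send to the
    interior. *)
Lemma topological_contraction_non_antipodal (R : realType) (m N : nat)
    (f : 'I_N -> 'rV[R]_m -> 'rV[R]_m) (K : set 'rV[R]_m) :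
  convex_body K -> topological_contraction f K -> non_antipodal f K.
Proof.
move=> [cK _ _] FK n.
have fK x : K x -> K° (f n x) by move=> Kx; apply: FK; exists n => //; exists x.
split=> [_ [x Kx <-] | x y [u _ [[_ [clKx _]] _]] [v _ [[_ [_ nint]] _]]].
  exact: interior_subset (fK x Kx).
apply: nint; apply: fK.
move: clKx; rewrite -(closure_id K).1 //.
by apply: compact_closed cK; exact: norm_hausdorff.
Qed.

(** All the maps contract the metric of the norm whose unit ball is [K - K]. *)
Lemma non_antipodal_hyperbolic (R : realType) (m N : nat)
    (f : 'I_N -> 'rV[R]_m -> 'rV[R]_m) (A : 'I_N -> 'M[R]_m) (b : 'I_N -> 'rV[R]_m)
    (K : set 'rV[R]_m) :
  (forall n x, f n x = x *m A n + b n) ->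
  convex_body K -> non_antipodal f K -> hyperbolic f.
Proof.
move=> f_def K_body nonantip.
have [r r0 lower] := polar_norm_lower K_body.
have [s s0 upper] := polar_norm_upper K_body.
exists (fun x y => polar_norm K (x - y)); split.
- split=> [x y | x y | x y | x y z].
  + exact: polar_norm_ge0.
  + split=> [xy0 | ->]; last first.
      apply/eqP; rewrite eq_le polar_norm_ge0 // andbT.
      by apply: le_trans (upper _) _; rewrite subrr /enorm dot0l sqrtr0 mulr0.
    apply/eqP; rewrite -subr_eq0; apply/eqP/enorm_eq0/eqP.
    rewrite eq_le enorm_ge0 andbT -(ler_pM2l r0) mulr0 -xy0; exact: lower.
  + by rewrite -polar_normN // opprB.
  + by rewrite -(subrKA y); exact: polar_normD.
- by exists r, s; split=> // x y; split; [exact: lower | exact: upper].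
- move=> n.
  have fB x y : f n x - f n y = (x - y) *m A n.
    by rewrite !f_def opprD addrACA subrr addr0 -mulmxBl.
  have [a [a0 a1 contr]] :=
    polar_norm_contraction K_body (f_continuous f_def (n:=n)) fB (nonantip n).
  by exists a; split=> // x y; rewrite fB.
Qed.

Theorem theorem1p1 (R : realType) (m N : nat) (hm : (0 < m)%N) (hN : (0 < N)%N)
    (f : 'I_N -> 'rV[R]_m -> 'rV[R]_m) (f_affine : forall n, is_affine (f n)) :
  [<-> hyperbolic f;
       point_fibred f;
       exists A : set 'rV[R]_m, is_attractor f A;
       exists K : set 'rV[R]_m, convex_body K /\ topological_contraction f K;
       exists K : set 'rV[R]_m, convex_body K /\ non_antipodal f K].
Proof.
have [A /choice [b f_def]] := choice f_affine.
split; last split; last split; last split.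
- move=> /(hyperbolic_jointly_contractive f_def).
  exact: jointly_contractive_point_fibred.
- exact: (point_fibred_attractor f_def (Ordinal hN)).
- move=> [A0 /(attractor_jointly_contractive f_def)].
  exact: jointly_contractive_topological_contraction.
- move=> [K [K_body FK]]; exists K; split=> //.
  exact: topological_contraction_non_antipodal.
- move=> [K [K_body nonantip]].
  exact: non_antipodal_hyperbolic f_def K_body nonantip.
Qed.
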